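(* Let $\mathcal{X}$ be a real Banach space, $\mathcal{C}\subset\mathcal{X}$ a closed pointed convex normal cone with nonempty interior $\mathcal{C}^0$, and $\mathbf{e}\in\mathcal{C}^0$. Let $B_H^\star(\mathbf{e})$ be the unit ball of $(\mathcal{M}(\mathbf{e}),\|\cdot\|_H^\star)$. Then the set of extreme points of $B_H^\star(\mathbf{e})$ is $$\operatorname{extr}B_H^\star(\mathbf{e})=\{\nu-\pi:\ \nu,\pi\in\operatorname{extr}\mathcal{P}(\mathbf{e}),\ \nu\perp\pi\}.$$
   Context: Pointed convex cone: $\alpha\mathcal{C}\subset\mathcal{C}$ for $\alpha\ge0$, $\mathcal{C}+\mathcal{C}\subset\mathcal{C}$, $\mathcal{C}\cap(-\mathcal{C})=\{0\}$. Order: $x\le y$ iff $y-x\in\mathcal{C}$. Normal: there is $K>0$ with $0\le x\le y\Rightarrow\|x\|\le K\|y\|$. Dual cone $\mathcal{C}^\star=\{\mu\in\mathcal{X}^\star:\langle\mu,x\rangle\ge0\ \forall x\in\mathcal{C}\}$, inducing the order on $\mathcal{X}^\star$ ($\mu\ge\mu'$ iff $\mu-\mu'\in\mathcal{C}^\star$). $\mathcal{P}(\mathbf{e})=\{\mu\in\mathcal{C}^\star:\langle\mu,\mathbf{e}\rangle=1\}$; $\mathcal{M}(\mathbf{e})=\{\mu\in\mathcal{X}^\star:\langle\mu,\mathbf{e}\rangle=0\}$. Thompson's norm: $\|x\|_T=\inf\{\alpha>0:-\alpha\mathbf{e}\le x\le\alpha\mathbf{e}\}$, with dual norm $\|\cdot\|_T^\star$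 on $\mathcal{X}^\star$; for $\mu\in\mathcal{M}(\mathbf{e})$, $\|\mu\|_H^\star=\frac12\|\mu\|_T^\star$ (this is the dual norm of Hopf's oscillation seminorm on $\mathcal{X}/\mathbb{R}\mathbf{e}$). $\operatorname{extr}$ denotes extreme points of a convex set. For $\nu,\pi\in\mathcal{P}(\mathbf{e})$, $\nu\perp\pi$ (disjoint) means: every $\mu\in\mathcal{P}(\mathbf{e})$ with $\mu\ge\nu/2$ and $\mu\ge\pi/2$ equals $(\nu+\pi)/2$. *)

(* Defs.v *)
From HB Require Import structures.
From mathcomp Require Import all_boot all_order all_algebra.
From mathcomp Require Import all_classical all_reals all_analysis.

Set Implicit Arguments.
Unset Strict Implicit.
Unset Printing Implicit Defensive.

Import Order.TTheory GRing.Theory Num.Theory.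
Import numFieldNormedType.Exports.

Local Open Scope classical_set_scope.
Local Open Scope ring_scope.

Definition pointed_convex_cone (R : realType) (V : lmodType R) (C : set V) :=
  [/\ forall (a : R) x, 0 <= a -> C x -> C (a *: x),
      forall x y, C x -> C y -> C (x + y)
    & C `&` [set - x | x in C] = [set 0]].

(* Used both for the order of C on the space and for the order of the dual
   cone on the dual space. *)
Definition cone_le (V : zmodType) (C : set V) (x y : V) := C (y - x).

Definition normal_cone (R : realType) (X : normedModType R) (C : set X) :=
  exists2 K : R, 0 < K &
    forall x y, cone_le C 0 x -> cone_le C x y -> `|x| <= K * `|y|.

Definition extreme_points (R : realType) (V : lmodType R) (A : set V) : set V :=
  [set x | A x /\
    forall (y z : V) (t : R), A y -> A z -> 0 < t -> t < 1 ->
      x = t *: y + (1 - t) *: z -> y = x /\ z = x].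

(* The dual space is a set of functions rather than a type: its linear
   structure is the pointwise one of X -> R^o. *)
Definition topological_dual (R : realType) (X : normedModType R) :
    set (X -> R^o) :=
  [set mu : X -> R^o | linear mu /\ continuous mu].

Definition dual_cone (R : realType) (X : normedModType R) (C : set X) :
    set (X -> R^o) :=
  [set mu | topological_dual mu /\ forall x, C x -> 0 <= mu x].

Definition cone_states (R : realType) (X : normedModType R) (C : set X)
    (e : X) : set (X -> R^o) :=
  [set mu | dual_cone C mu /\ mu e = 1].

Definition annihilator (R : realType) (X : normedModType R) (e : X) :
    set (X -> R^o) :=
  [set mu | topological_dual mu /\ mu e = 0].

(* If e is interior to C, this infimum is over a nonempty set. *)
Definition thompson_norm (R : realType) (X : normedModType R) (C : set X)
    (e x : X) : R :=
  inf [set a : R | [/\ 0 < a, cone_le C (- (a *: e)) x & cone_le C x (a *: e)]].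

(* If C is normal and e is interior to C, the Thompson unit ball is bounded in
   norm, so that this real supremum is over a bounded set for every mu in the
   dual space. *)
Definition thompson_dual_norm (R : realType) (X : normedModType R) (C : set X)
    (e : X) (mu : X -> R^o) : R :=
  sup [set `|mu x : R| | x in [set x | thompson_norm C e x <= 1]].

Definition hopf_dual_norm (R : realType) (X : normedModType R) (C : set X)
    (e : X) (mu : X -> R^o) : R :=
  2^-1 * thompson_dual_norm C e mu.

Definition hopf_dual_ball (R : realType) (X : normedModType R) (C : set X)
    (e : X) : set (X -> R^o) :=
  [set mu | annihilator e mu /\ hopf_dual_norm C e mu <= 1].

Definition disjoint_states (R : realType) (X : normedModType R) (C : set X)
    (e : X) (nu rho : X -> R^o) :=
  forall mu : X -> R^o, cone_states C e mu ->
    cone_le (dual_cone C) (2^-1 *: nu) mu ->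
    cone_le (dual_cone C) (2^-1 *: rho) mu ->
    mu = 2^-1 *: (nu + rho).

(* Main.v *)
Require Import Defs.
From HB Require Import structures.
From mathcomp Require Import all_boot all_order all_algebra.
From mathcomp Require Import all_classical all_reals all_analysis.
From mathcomp Require Import ring lra.

Import Order.TTheory GRing.Theory Num.Theory.
Import numFieldNormedType.Exports.

(** The ball of Hopf's dual norm consists exactly of the differences of two
    states, and after that the theorem is convex geometry.

    A difference of states lies in the ball because a state is bounded by [a]
    on [- a e <= x <= a e] ([cone_state_sub_in_hopf_dual_ball]).  Conversely
    ([hopf_dual_ball_decomposition]), writing a functional [f] of the ball as a
    difference of states [(f + g) - g] means finding a linear [g] with
    [g e = 1] that is nonnegative and at least [- f] on the cone.  These
    constraints ask [g] to lie below prescribed values on a convex cone of the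
    product of the space with the line, so that the geometric Hahn-Banach
    theorem [hahn_banach_cone] provides [g] as soon as the constraints are
    consistent at the origin.  There, they amount to [f b >= - s] whenever
    [0 <= b <= s e], and this holds because [f] vanishes at [e] and is bounded
    by 2 on [- e <= x <= e]: take [x = (2 / s) b - e].

    Extreme points of the ball: if [nu - rho] is extreme, splitting [nu] or
    [rho] splits [nu - rho], so that both are extreme states
    ([extreme_difference]).  Moreover [nu] and [rho] are the only states with
    this difference, since the midpoint of two decompositions is again a
    decomposition and hence consists of extreme states
    ([extreme_difference_unique]).  A state [m] above [nu / 2] and [rho / 2]
    yields a second decomposition [(2 m - rho) - (2 m - nu)], so that
    [m = (nu + rho) / 2]: the states are disjoint.

    Conversely, let [nu] and [rho] be disjoint extreme states.  A convex
    splitting of [nu - rho] in the ball becomes, after each piece is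
    decomposed, an equality [nu - rho = nut - rhot] where [nut] and [rhot] are
    convex combinations of states.  Then [(nu + rhot) / 2 = (rho + nut) / 2] is
    a state above both halves, disjointness forces [rhot = rho] and
    [nut = nu], and extremality makes the combinations trivial. *)

Local Open Scope classical_set_scope.
Local Open Scope ring_scope.

(** * A geometric Hahn-Banach theorem *)

(** A pair [(x, t)] of [A] stands for the constraint [f x <= t] on a linear
    form [f].  The constraints that follow from given ones form a convex cone,
    and the last clause, the constraint at [x = 0], is their consistency. *)
Definition nonneg_over_0_cone {R : realType} {V : lmodType R}
    (A : set (V * R)) :=
  [/\ forall (a : R) x t, 0 <= a -> A (x, t) -> A (a *: x, a * t),
      forall x t y s, A (x, t) -> A (y, s) -> A (x + y, t + s)
    & forall t, A (0, t) -> 0 <= t].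

(** Zorn's lemma applies because each clause of [nonneg_over_0_cone] involves
    finitely many points, hence passes to unions of chains. *)
Lemma maximal_nonneg_over_0_cone {R : realType} {V : lmodType R}
    {A : set (V * R)} :
  nonneg_over_0_cone A -> A !=set0 ->
  exists M, [/\ A `<=` M, nonneg_over_0_cone M &
    forall B, nonneg_over_0_cone B -> M `<=` B -> B `<=` M].
Proof.
move=> coneA [u0 Au0].
(* The empty chain has an empty union, so that the empty set must belong to
   the family: only nonempty members are asked to contain A. *)
pose P := [set B : set (V * R) |
  nonneg_over_0_cone B /\ (B !=set0 -> A `<=` B)].
have [|M [[coneM AM] maxM]] := @Zorn_bigcup _ P.
  move=> F FP Ftot; split; last first.
    move=> [u [B FB Bu]] v Av; exists B => //.
    by apply: (FP _ FB).2 => //; exists u.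
  split.
  - move=> a x t a0 [B FB Bxt]; exists B => //.
    by have [[BZ _ _] _] := FP _ FB; exact: BZ.
  - move=> x t y s [B FB Bxt] [D FD Dys].
    have [BD|DB] := Ftot _ _ FB FD.
      by exists D => //; have [[_ DD _] _] := FP _ FD; apply: DD => //; exact: BD.
    by exists B => //; have [[_ BD _] _] := FP _ FB; apply: BD => //; exact: DB.
  - by move=> t [B FB Bt]; have [[_ _ B0] _] := FP _ FB; exact: B0.
have {}AM : A `<=` M.
  have [M0|/set0P M0] := eqVneq M set0; last exact: AM.
  exfalso; apply: (maxM A); last by split=> // _ u Au.
  by rewrite M0; split=> // /(_ u0 Au0).
exists M; split=> // B coneB MB.
apply: contrapT => nBM; apply: (maxM B) => //; split => // _.
exact: subset_trans MB.
Qed.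

(** In a maximal consistent cone [M], every constraint compatible with [M] is
    already in [M].  With [f x] the best upper bound that [M] imposes at [x],
    the constraint [(y, - f (- y))] is compatible, so that [f] is odd and
    attains its infimum.  Being sublinear and odd, [f] is linear. *)
Lemma hahn_banach_cone {R : realType} {V : lmodType R}
    {A : set (V * R)} :
  nonneg_over_0_cone A -> (forall x, exists t, A (x, t)) ->
  exists f : {linear V -> R^o}, forall x t, A (x, t) -> f x <= t.
Proof.
move=> coneA totA.
have [|M [AM [MZ MD M_ge0] maxM]] := maximal_nonneg_over_0_cone coneA.
  by have [t At] := totA 0; exists (0, t).
have totM x : exists t, M (x, t) by have [t /AM] := totA x; exists t.
have M00 : M (0, 0).
  by have [t /(MZ 0 _ _ (lexx _))] := totM 0; rewrite scaler0 mul0r.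
have M_opp x t s : M (x, t) -> M (- x, s) -> 0 <= t + s.
  by move=> Mt Ms; apply: M_ge0; rewrite -(subrr x); exact: MD.
have maxM_pt y s : (forall t, M (- y, t) -> 0 <= t + s) -> M (y, s).
  move=> ys_ge0.
  (* N is the cone generated by M and (y, s). *)
  pose N := [set u : V * R |
    exists2 a : R, 0 <= a & M (u.1 - a *: y, u.2 - a * s)].
  have : N `<=` M.
    apply: maxM; last first.
      by move=> [x t] Mxt; exists 0 => //=; rewrite scale0r mul0r !subr0.
    split.
    - move=> k x t k0 [a a0 /= Ma]; exists (k * a); first exact: mulr_ge0.
      by rewrite /= -scalerA -scalerBr -mulrA -mulrBr; exact: MZ.
    - move=> x t x' t' [a a0 /= Ma] [b b0 /= Mb]; exists (a + b).
        exact: addr_ge0.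
      by rewrite /= scalerDl mulrDl !opprD (addrACA x) (addrACA t); exact: MD.
    - move=> t [a]; rewrite le_eqVlt => /predU1P[<- /=|a0 /=].
        by rewrite scale0r mul0r !subr0; exact: M_ge0.
      have ai0 : 0 <= a^-1 by rewrite invr_ge0 ltW.
      move=> /(MZ _ _ _ ai0).
      rewrite sub0r scalerN scalerA mulVf ?gt_eqF// scale1r => /ys_ge0.
      rewrite mulrBr mulrA mulVf ?gt_eqF// mul1r subrK.
      by rewrite pmulr_rge0// invr_gt0.
  apply; exists 1 => //=.
  by rewrite scale1r mul1r !subrr.
pose f x : R^o := inf [set t | M (x, t)].
have f_le x t : M (x, t) -> f x <= t.
  move=> Mxt; apply: ge_inf => //.
  have [s Ms] := totM (- x); exists (- s) => r /= Mr.
  by rewrite lerNl -subr_ge0 opprK addrC; exact: (M_opp x).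
have le_f x s : (forall t, M (x, t) -> s <= t) -> s <= f x.
  by move=> sM; apply: lb_le_inf; [have [t] := totM x; exists t|].
have M_fN y : M (y, - f (- y)).
  by apply: maxM_pt => t /f_le; rewrite subr_ge0.
have fN x : f (- x) = - f x.
  apply/eqP; rewrite eq_le lerNr f_le//= lerNl.
  apply: (le_f _) => t Mt; rewrite lerNl.
  by apply: (le_f _) => s Ms; rewrite -subr_ge0 opprK addrC; exact: (M_opp x).
have M_f x : M (x, f x) by rewrite -[f x]opprK -fN.
have f_subadd x y : f (x + y) <= f x + f y by apply/f_le/MD.
have f_add x y : f (x + y) = f x + f y.
  apply/eqP; rewrite eq_le f_subadd/=.
  by rewrite -lerBrDr -fN -{1}(addrK y x) f_subadd.
have f_subscale a x : 0 <= a -> f (a *: x) <= a * f x.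
  by move=> a0; apply/f_le/MZ.
have f_posscale a x : 0 <= a -> f (a *: x) = a * f x.
  move=> a0; apply/eqP; rewrite eq_le f_subscale//=.
  by rewrite -lerN2 -fN -mulrN -fN -scalerN f_subscale.
have f_lin : linear f.
  move=> a x y; rewrite f_add; congr (_ + _).
  have [a0|/ltW a0] := leP 0 a; first exact: f_posscale.
  by rewrite -[a]opprK scaleNr fN f_posscale ?oppr_ge0// scaleNr.
pose F := GRing.isLinear.Build R V R^o _ f f_lin.
exists (HB.pack_for {linear V -> R^o} f F) => x t /AM; exact: f_le.
Qed.

(** * Order units and positive functionals *)

(** A ball of radius [r] around [e] lies in [C].  The factor is [2 / r] rather
    than [1 / r] because the ball is open. *)
Lemma order_unit_bound {R : realType} {X : normedModType R} {C : set X}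
    {e : X} :
  pointed_convex_cone C -> C° e ->
  exists2 k : R, 0 < k & forall x, C ((k * `|x|) *: e - x).
Proof.
move=> [CZ _ _] /nbhs_ballP[r /= r0 rC].
have C0 : C 0 by rewrite -(scale0r e); apply: CZ => //; apply/rC/ballxx.
exists (2 / r) => [|x]; first by rewrite divr_gt0.
have [->|x0] := eqVneq x 0; first by rewrite normr0 mulr0 scale0r subr0.
have nx0 : 0 < `|x| by rewrite normr_gt0.
set s := 2 / r * `|x|.
have s0 : 0 < s by rewrite mulr_gt0// divr_gt0.
have -> : s *: e - x = s *: (e - s^-1 *: x).
  by rewrite scalerBr scalerA divff ?gt_eqF// scale1r.
apply: CZ; first exact: ltW.
apply: rC; rewrite -ball_normE /= opprB addrC subrK normrZ gtr0_norm ?invr_gt0//.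
rewrite /s invfM invf_div -mulrA mulVf ?gt_eqF// mulr1.
by rewrite gtr_pMr// invf_lt1// ltr1n.
Qed.

Lemma pointed_cone_eq0 {R : realType} {V : lmodType R} {C : set V} {x : V} :
  pointed_convex_cone C -> C x -> C (- x) -> x = 0.
Proof.
move=> [_ _ C0] Cx CNx.
suff : (C `&` [set - y | y in C]) x by rewrite C0.
by split => //; exists (- x) => //; rewrite opprK.
Qed.

(** If [- e] were in [C], then [e] being an order unit would put every vector
    of the space in [C], which contradicts pointedness. *)
Lemma order_unit_scale_ge0 {R : realType} {X : normedModType R} {C : set X}
    {e : X} {s : R} :
  (exists x : X, x <> 0) -> pointed_convex_cone C -> C° e ->
  C (s *: e) -> 0 <= s.
Proof.
move=> [x x_neq0] coneC eC Cse; rewrite leNgt; apply/negP => s0.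
have [CZ CD _] := coneC.
have [k k0 kC] := order_unit_bound coneC eC.
have CN y : C (- y).
  have -> : - y = ((k * `|y|) *: e - y) + (- (k * `|y|) / s) *: (s *: e).
    by rewrite scalerA divfK ?lt_eqF// scaleNr addrC addKr.
  apply: CD => //; apply: CZ => //.
  rewrite mulNr -mulrN -invrN divr_ge0 ?mulr_ge0 ?(ltW k0)//.
  by rewrite oppr_ge0 ltW.
by apply/x_neq0/(pointed_cone_eq0 coneC) => //; rewrite -(opprK x).
Qed.

(** A positive form satisfies [`|f x| <= k * `|x| * f e], by positivity at
    [k * `|x| *: e - x] and at its analogue for [- x]. *)
Lemma positive_linear_continuous {R : realType} {X : normedModType R}
    {C : set X} {e : X} (f : {linear X -> R^o}) :
  pointed_convex_cone C -> C° e -> (forall x, C x -> 0 <= f x) ->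
  continuous f.
Proof.
move=> coneC eC f_ge0; apply/linear_bounded_continuous/bounded_funP => r.
have [k k0 kC] := order_unit_bound coneC eC.
have f_le x : f x <= k * `|x| * f e.
  by have := f_ge0 _ (kC x); rewrite linearB linearZ/= subr_ge0.
have fe0 : 0 <= f e by apply: (f_ge0 _ (interior_subset eC)).
exists (k * r * f e) => x xr.
have kxr : k * `|x| * f e <= k * r * f e.
  by rewrite ler_wpM2r// ler_wpM2l// ltW.
rewrite ler_norml (le_trans (f_le x) kxr) andbT lerNl -linearN.
by rewrite (le_trans (f_le _))// normrN.
Qed.

(** Gives access to the theory of bundled linear maps, the dual space being
    defined by the bare predicate [linear]. *)
Lemma linear_of_dual {R : realType} {X : normedModType R} {mu : X -> R^o} :
  linear mu -> exists f : {linear X -> R^o}, mu = f.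
Proof.
move=> mu_lin; pose F := GRing.isLinear.Build R X R^o _ mu mu_lin.
by exists (HB.pack_for {linear X -> R^o} mu F).
Qed.

Lemma topological_dual_comb {R : realType} {X : normedModType R}
    (a b : R) {mu nu : X -> R^o} :
  topological_dual mu -> topological_dual nu ->
  topological_dual (a *: mu + b *: nu).
Proof.
move=> [mu_lin mu_cont] [nu_lin nu_cont]; split.
  move=> c x y; rewrite !fctE mu_lin nu_lin !scalerDr addrACA !scalerA.
  by rewrite ![c * _]mulrC.
move=> x; apply: cvgD; apply: cvgZr; [exact: mu_cont|exact: nu_cont].
Qed.

Lemma dual_cone_comb {R : realType} {X : normedModType R} {C : set X}
    (a b : R) {mu nu : X -> R^o} :
  0 <= a -> 0 <= b -> dual_cone C mu -> dual_cone C nu ->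
  dual_cone C (a *: mu + b *: nu).
Proof.
move=> a0 b0 [mu_dual mu_ge0] [nu_dual nu_ge0]; split.
  exact: topological_dual_comb.
by move=> x Cx; rewrite !fctE addr_ge0// mulr_ge0 ?mu_ge0 ?nu_ge0.
Qed.

Lemma cone_states_convex {R : realType} {X : normedModType R} {C : set X}
    {e : X} (t : R) {mu nu : X -> R^o} :
  0 <= t -> t <= 1 -> cone_states C e mu -> cone_states C e nu ->
  cone_states C e (t *: mu + (1 - t) *: nu).
Proof.
move=> t0 t1 [mu_pos mue] [nu_pos nue]; split.
  by apply: dual_cone_comb; rewrite ?subr_ge0.
by rewrite !fctE mue nue -scalerDl addrC subrK scale1r.
Qed.

(** * States and the dual ball *)

Lemma thompson_norm_le1 {R : realType} {X : normedModType R} {C : set X}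
    {e x : X} :
  cone_le C (- e) x -> cone_le C x e -> thompson_norm C e x <= 1.
Proof.
move=> ex xe; apply: ge_inf; last by rewrite /= scale1r.
by exists 0 => a [/ltW].
Qed.

(** The infimum defining the norm is only approached, hence the slack between
    [1] and [r]. *)
Lemma thompson_norm_le1_bound {R : realType} {X : normedModType R}
    {C : set X} {e x : X} (r : R) :
  pointed_convex_cone C -> C° e -> thompson_norm C e x <= 1 -> 1 < r ->
  exists2 a : R, a < r &
    [/\ 0 < a, cone_le C (- (a *: e)) x & cone_le C x (a *: e)].
Proof.
move=> coneC eC x1 r1; have [CZ CD _] := coneC.
have [|a ha ar] := @inf_lt _ [set a : R |
    [/\ 0 < a, cone_le C (- (a *: e)) x & cone_le C x (a *: e)]] r _
    (le_lt_trans x1 r1); last by exists a.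
have [k k0 kC] := order_unit_bound coneC eC.
have Ce : C e by exact: interior_subset.
have Ck1 y : C ((k * `|y| + 1) *: e - y).
  by rewrite scalerDl scale1r addrAC; exact: CD.
exists (k * `|x| + 1); split.
- by rewrite ltr_wpDl// mulr_ge0// ltW.
- by have := Ck1 (- x); rewrite /cone_le normrN !opprK addrC.
- exact: Ck1.
Qed.

(** Normality makes the Thompson ball bounded in norm, so that the values of
    the continuous [mu] on it are bounded: the supremum in the definition of
    the dual norm is then a true upper bound. *)
Lemma hopf_dual_ball_bound {R : realType} {X : normedModType R} {C : set X}
    {e : X} {mu : X -> R^o} {x : X} :
  pointed_convex_cone C -> normal_cone C -> C° e ->
  hopf_dual_ball C e mu -> cone_le C (- e) x -> cone_le C x e ->
  `|mu x : R| <= 2.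
Proof.
move=> coneC [K K0 CK] eC [[[mu_lin mu_cont] _] mu1] ex xe.
have sup2 : thompson_dual_norm C e mu <= 2.
  by move: mu1; rewrite /hopf_dual_norm ler_pdivrMl// mulr1.
apply: le_trans sup2; apply: ub_le_sup; last first.
  by exists x => //; exact: thompson_norm_le1.
have [f muE] := linear_of_dual mu_lin; subst mu.
have /bounded_funP fbnd : bounded_near f (nbhs 0).
  exact/linear_bounded_continuous.
have [M fM] := fbnd (K * (4 * `|e|) + 2 * `|e|).
exists M => _ [y /= y1 <-]; apply: fM.
(* From 0 <= y + a e <= 2 a e with a < 2, normality bounds y + a e. *)
have [a a2 [a0 ay ya]] :=
  thompson_norm_le1_bound 2 coneC eC y1 (ltr1n _ 2).
have ny : `|y + a *: e| <= K * (4 * `|e|).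
  apply: (le_trans (CK _ ((2 * a) *: e) _ _)).
  - by move: ay; rewrite /cone_le opprK subr0.
  - move: ya; rewrite /cone_le mulr_natl mulr2n scalerDl opprD.
    by rewrite addrACA subrr addr0.
  - rewrite ler_wpM2l ?(ltW K0)// normrZ ler_wpM2r// gtr0_norm ?mulr_gt0//.
    by rewrite -[4]/(2 * 2)%:R natrM ler_wpM2l// ltW.
rewrite -[y](addrK (a *: e)) (le_trans (ler_normB _ _))// lerD//.
by rewrite normrZ gtr0_norm// ler_wpM2r// ltW.
Qed.

Lemma cone_state_sub_in_hopf_dual_ball {R : realType} {X : normedModType R}
    {C : set X} {e : X} {nu rho : X -> R^o} :
  pointed_convex_cone C -> C° e ->
  cone_states C e nu -> cone_states C e rho ->
  hopf_dual_ball C e (nu - rho).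
Proof.
move=> coneC eC [[nu_dual nu_ge0] nue] [[rho_dual rho_ge0] rhoe]; split.
  split; last by rewrite !fctE nue rhoe subrr.
  by have := topological_dual_comb 1 (-1) nu_dual rho_dual;
    rewrite scale1r scaleN1r.
rewrite /hopf_dual_norm ler_pdivrMl// mulr1.
have Ce : C e by exact: interior_subset.
have [CZ _ _] := coneC.
have C0 : C 0 by rewrite -(scale0r e); exact: CZ.
apply: ge_sup.
  exists `|(nu - rho) 0 : R|; exists 0 => //=.
  by apply: thompson_norm_le1; rewrite /cone_le ?sub0r ?opprK ?subr0.
move=> _ [x /= x1 <-]; apply/ler_addgt0Pr => eps eps0.
have r1 : 1 < 1 + eps / 2 by rewrite ltrDl divr_gt0.
have [a ar [a0 ax xa]] := thompson_norm_le1_bound _ coneC eC x1 r1.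
have state_bound (mu : X -> R^o) : linear mu ->
    (forall x, C x -> 0 <= mu x) -> mu e = 1 -> `|mu x : R| <= a.
  move=> /linear_of_dual[f ->] f_ge0 fe; rewrite ler_norml.
  have := f_ge0 _ ax; have := f_ge0 _ xa.
  rewrite !linearB !linearN !linearZ/= fe /GRing.scale/= mulr1; lra.
have nux := state_bound _ nu_dual.1 nu_ge0 nue.
have rhox := state_bound _ rho_dual.1 rho_ge0 rhoe.
rewrite !fctE (le_trans (ler_normB _ _))//; lra.
Qed.

(** With [x = s e - a - b] and [a, b] in the cone, a form [g] as wanted
    satisfies [g x <= s + mu b]: these are the constraints given to
    [hahn_banach_cone].  Positivity of [g] comes back from [x = - a],
    positivity of [mu + g] from [x = - b], and [g e = 1] from [x = e] and
    [x = - e]. *)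
Lemma hopf_dual_ball_decomposition {R : realType} {X : normedModType R}
    {C : set X} {e : X} {mu : X -> R^o} :
  (exists x : X, x <> 0) ->
  pointed_convex_cone C -> normal_cone C -> C° e ->
  hopf_dual_ball C e mu ->
  exists nu rho : X -> R^o,
    [/\ cone_states C e nu, cone_states C e rho & mu = nu - rho].
Proof.
move=> X_neq0 coneC normalC eC ball_mu; have [CZ CD _] := coneC.
have [[[mu_lin mu_cont] mue] _] := ball_mu.
have Ce : C e by exact: interior_subset.
have C0 : C 0 by rewrite -(scale0r e); exact: CZ.
have [k k0 kC] := order_unit_bound coneC eC.
have [f muE] := linear_of_dual mu_lin; subst mu.
pose A := [set u : X * R | exists s a b,
  [/\ C a, C b, u.1 = s *: e - a - b & u.2 = s + f b]].
have coneA : nonneg_over_0_cone A.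
  split.
  - move=> c x t c0 [s [a [b /= [Ca Cb -> ->]]]].
    exists (c * s), (c *: a), (c *: b); split; [exact: CZ|exact: CZ| |] => /=.
      by rewrite !scalerBr scalerA.
    by rewrite linearZ/= mulrDr.
  - move=> _ _ _ _ [s [a [b /= [Ca Cb -> ->]]]] [s' [a' [b' /= [Ca' Cb' -> ->]]]].
    exists (s + s'), (a + a'), (b + b'); split; [exact: CD|exact: CD| |] => /=.
      by rewrite scalerDl !opprD (addrACA (s *: e)) (addrACA (s *: e - a)).
    by rewrite linearD/= addrACA.
  - move=> t [s [a [b /= [Ca Cb /esym/eqP + ->]]]].
    rewrite -addrA -opprD subr_eq0 => /eqP seE.
    have [s0|s0] := leP s 0.
      have s_ge0 : 0 <= s.
        by apply: (order_unit_scale_ge0 X_neq0 coneC eC); rewrite seE; exact: CD.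
      have s00 : s = 0 by apply: le_anti; rewrite s0 s_ge0.
      move: seE; rewrite s00 scale0r => /esym/eqP; rewrite addr_eq0 => /eqP aE.
      have -> : b = 0 by apply: (pointed_cone_eq0 coneC) => //; rewrite -aE.
      by rewrite linear0 addr0.
    (* As a + b = s e, the vector (2 / s) b - e lies between - e and e. *)
    have s2 : 0 <= 2 / s by rewrite divr_ge0// ltW.
    have e2 : e + e = (2 / s) *: (a + b).
      by rewrite -seE scalerA divfK ?gt_eqF// scaler_nat mulr2n.
    have := @hopf_dual_ball_bound _ _ _ _ _ ((2 / s) *: b - e)
      coneC normalC eC ball_mu.
    rewrite /cone_le opprK subrK opprB addrA e2 scalerDr addrK.
    move=> /(_ (CZ _ _ s2 Cb) (CZ _ _ s2 Ca)).
    rewrite linearB linearZ/= mue subr0 ler_norml => /andP[+ _].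
    have -> : (2 / s) *: f b = 2 * (f b / s) :> R.
      by rewrite /GRing.scale/= mulrAC mulrA.
    move=> fbs; have : -1 <= f b / s by lra.
    by rewrite ler_pdivlMr//; lra.
have totA x : exists t, A (x, t).
  exists (k * `|x|), (k * `|x|), ((k * `|x|) *: e - x), 0; split => //=.
    by rewrite subr0 opprB addrC subrK.
  by rewrite linear0 addr0.
have [g gA] := hahn_banach_cone coneA totA.
have g_ge0 x : C x -> 0 <= g x.
  move=> Cx; rewrite -oppr_le0 -linearN; apply: gA.
  by exists 0, x, 0; rewrite scale0r sub0r subr0 linear0 addr0.
have fg_ge0 x : C x -> 0 <= f x + g x.
  move=> Cx; have : g (- x) <= f x.
    by apply: gA; exists 0, 0, x; rewrite scale0r subr0 sub0r add0r.
  by rewrite linearN -subr_ge0 opprK.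
have ge1 : g e = 1.
  apply/eqP; rewrite eq_le; apply/andP; split.
    apply: gA; exists 1, 0, 0.
    by rewrite scale1r !subr0 linear0 addr0.
  rewrite -lerN2 -linearN; apply: gA; exists (-1), 0, 0.
  by rewrite scaleN1r !subr0 linear0 addr0.
have g_dual : topological_dual g.
  by split; [exact: linearP|exact: positive_linear_continuous coneC eC g_ge0].
exists ((f : X -> R^o) + (g : X -> R^o)), g; split; last by rewrite addrK.
- split; last by rewrite !fctE mue ge1 add0r.
  split; last exact: fg_ge0.
  have := topological_dual_comb 1 1 (conj mu_lin mu_cont) g_dual.
  by rewrite !scale1r.
- by split.
Qed.

(** * Extreme points of a set of differences *)

(** A convex splitting of [nu] becomes one of [nu - rho] by translation, and
    likewise for [rho]. *)
Lemma extreme_difference {R : realType} {V : lmodType R} {P B : set V}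
    {nu rho : V} :
  (forall x y, P x -> P y -> B (x - y)) -> P nu -> P rho ->
  extreme_points B (nu - rho) ->
  extreme_points P nu /\ extreme_points P rho.
Proof.
move=> PB Pnu Prho [_ ext]; split; split => // y z t Py Pz t0 t1 def_x.
- have [|||yE zE] := ext (y - rho) (z - rho) t _ _ t0 t1.
  + exact: PB.
  + exact: PB.
  + rewrite def_x !scalerBr addrACA -opprD -scalerDl.
    by rewrite [t + _]addrC subrK scale1r.
  + by split; [exact: (addIr _ yE)|exact: (addIr _ zE)].
- have [|||yE zE] := ext (nu - y) (nu - z) t _ _ t0 t1.
  + exact: PB.
  + exact: PB.
  + rewrite def_x !scalerBr addrACA -opprD -scalerDl.
    by rewrite [t + _]addrC subrK scale1r.
  + by split; apply: oppr_inj; [exact: (addrI _ yE)|exact: (addrI _ zE)].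
Qed.

(** The midpoints of [nu, nu'] and of [rho, rho'] have the same difference, so
    that they are extreme in [P]: the first one cannot be a proper midpoint. *)
Lemma extreme_difference_unique {R : realType} {V : lmodType R} {P B : set V}
    {nu rho nu' rho' : V} :
  (forall x y, P x -> P y -> B (x - y)) ->
  (forall x y, P x -> P y -> P (2^-1 *: x + (1 - 2^-1) *: y)) ->
  extreme_points B (nu - rho) -> P nu -> P rho -> P nu' -> P rho' ->
  nu' - rho' = nu - rho -> nu' = nu.
Proof.
move=> PB Pconv ext Pnu Prho Pnu' Prho' eq_diff.
have h0 : (0 : R) < 2^-1 by rewrite invr_gt0.
have h1 : (2^-1 : R) < 1 by rewrite invf_lt1// ltr1n.
pose m x y : V := 2^-1 *: x + (1 - 2^-1) *: y.
have eq_mid : m nu nu' - m rho rho' = nu - rho.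
  rewrite /m opprD addrACA -!scalerBr eq_diff -scalerDl.
  by rewrite [_ + (1 - _)]addrC subrK scale1r.
move: ext; rewrite -eq_mid => /(extreme_difference PB) [||[_ ext] _].
- exact: Pconv.
- exact: Pconv.
have [nuE nu'E] := ext nu nu' 2^-1 Pnu Pnu' h0 h1 erefl.
exact: etrans nu'E (esym nuE).
Qed.

Theorem theorem2p12 (R : realType) (X : completeNormedModType R)
  (X_neq0 : exists x : X, x <> 0)
  (C : set X) (C_closed : closed C) (C_cone : pointed_convex_cone C)
  (C_normal : normal_cone C) (e : X) (e_int : C° e) :
  extreme_points (hopf_dual_ball C e) =
  [set mu | exists nu rho : X -> R^o,
    [/\ extreme_points (cone_states C e) nu,
        extreme_points (cone_states C e) rho,
        disjoint_states C e nu rho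
      & mu = nu - rho]].
Proof.
have diff_in_ball (nu rho : X -> R^o) : cone_states C e nu ->
    cone_states C e rho -> hopf_dual_ball C e (nu - rho).
  exact: cone_state_sub_in_hopf_dual_ball.
have h0 : (0 : R) <= 2^-1 by rewrite invr_ge0.
have h1 : (2^-1 : R) <= 1 by rewrite invf_le1// ler1n.
(* The reflection of nu through mu is a state as soon as mu >= nu / 2. *)
have state_reflect (nu mu : X -> R^o) : cone_states C e nu ->
    cone_states C e mu -> cone_le (dual_cone C) (2^-1 *: nu) mu ->
    cone_states C e (2 *: mu - nu).
  move=> [_ nue] [_ mue] le_nu_mu; split; last first.
    by rewrite !fctE nue mue /GRing.scale/= mulr1 -[2]/(1 + 1) addrK.
  have := dual_cone_comb 2 0 (ler0n _ _) (lexx 0) le_nu_mu le_nu_mu.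
  by rewrite scale0r addr0 scalerBr scalerA divff ?scale1r// pnatr_eq0.
apply/seteqP; split=> [mu mu_ext|mu [nu [rho [nu_ext rho_ext disj ->]]]].
- have [nu [rho [Pnu Prho muE]]] :=
    hopf_dual_ball_decomposition X_neq0 C_cone C_normal e_int mu_ext.1.
  rewrite {}muE in mu_ext *; exists nu, rho.
  have [nu_ext rho_ext] := extreme_difference diff_in_ball Pnu Prho mu_ext.
  split=> // m Pm le_nu_m le_rho_m.
  have mE : 2 *: m - rho = nu.
    apply: (extreme_difference_unique diff_in_ball _ mu_ext Pnu Prho
      (state_reflect _ _ Prho Pm le_rho_m) (state_reflect _ _ Pnu Pm le_nu_m)).
      by move=> x y; exact: cone_states_convex.
    by rewrite opprB addrC addrA subrK.
  by rewrite -mE subrK scalerA mulVf ?scale1r// pnatr_eq0.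
- have [Pnu nu_extr] := nu_ext; have [Prho rho_extr] := rho_ext.
  split; first exact: diff_in_ball.
  move=> y z t ball_y ball_z t0 t1 def_diff.
  have [nu1 [rho1 [Pnu1 Prho1 yE]]] :=
    hopf_dual_ball_decomposition X_neq0 C_cone C_normal e_int ball_y.
  have [nu2 [rho2 [Pnu2 Prho2 zE]]] :=
    hopf_dual_ball_decomposition X_neq0 C_cone C_normal e_int ball_z.
  have [t0' t1'] := (ltW t0, ltW t1).
  set nut := t *: nu1 + (1 - t) *: nu2.
  set rhot := t *: rho1 + (1 - t) *: rho2.
  have Pnut : cone_states C e nut by exact: cone_states_convex.
  have Prhot : cone_states C e rhot by exact: cone_states_convex.
  have diffE : nu - rho = nut - rhot.
    by rewrite def_diff yE zE !scalerBr addrACA -opprD.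
  have cross : nu + rhot = rho + nut.
    by rewrite -[nu](subrK rho) diffE addrAC subrK addrC.
  have halfC : 1 - 2^-1 = 2^-1 :> R by lra.
  have PD x : cone_states C e x -> dual_cone C (2^-1 *: x).
    move=> [Dx _]; have := dual_cone_comb 2^-1 0 h0 (lexx 0) Dx Dx.
    by rewrite scale0r addr0.
  (* By cross, this state is above both nu / 2 and rho / 2. *)
  have mid : 2^-1 *: (nu + rhot) = 2^-1 *: (nu + rho).
    apply: disj.
    - rewrite scalerDr -{2}halfC; exact: cone_states_convex.
    - by rewrite /cone_le -scalerBr addrC addKr; exact: PD.
    - by rewrite /cone_le cross -scalerBr addrC addKr; exact: PD.
  have h2 : (2^-1 : R) != 0 by rewrite invr_eq0 pnatr_eq0.
  have rhotE : rho = rhot by apply/esym/(addrI _ (scalerI h2 mid)).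
  have nutE : nu = nut by move: cross; rewrite -rhotE addrC => /addrI.
  have [nu1E nu2E] := nu_extr nu1 nu2 t Pnu1 Pnu2 t0 t1 nutE.
  have [rho1E rho2E] := rho_extr rho1 rho2 t Prho1 Prho2 t0 t1 rhotE.
  by rewrite yE zE nu1E nu2E rho1E rho2E.
Qed.
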